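(* Let $\mathcal{A} \subseteq \mathbb{C}^{n \times n}$ be a matrix $*$-algebra. Then there are a nonnegative integer $d$ and positive integers $m_1, \ldots, m_d$ such that there is a $*$-isomorphism between $\mathcal{A}$ and a direct sum of complete matrix algebras $$\varphi : \mathcal{A} \to \bigoplus_{k=1}^d \mathbb{C}^{m_k \times m_k}.$$
   Context: A matrix $*$-algebra is a complex linear subspace $\mathcal{A}\subseteq \mathbb{C}^{n\times n}$ that is closed under matrix multiplication and under taking the conjugate transpose $A \mapsto A^*$ (it is not required to contain the identity matrix $I_n$, and $\{0\}$ is allowed). The direct sum $\bigoplus_{k=1}^d \mathbb{C}^{m_k\times m_k}$ is the algebra of block-diagonal matrices with $k$-th block an arbitrary complex $m_k\times m_k$ matrix. A map $\varphi:\mathcal{A}\to\mathcal{B}$ between matrix $*$-algebras is a $*$-homomorphism if it is $\mathbb{C}$-linear, $\varphi(AB)=\varphi(A)\varphi(B)$ and $\varphi(A^* )=\varphi(A)^*$ for all $A,B\in\mathcal{A}$; it is a $*$-isomorphism if it is moreover bijective. *)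

(* Defs.v *)
From HB Require Import structures.
From mathcomp Require Import all_boot all_order all_algebra.
From mathcomp Require Import sesquilinear spectral.
From mathcomp Require Import boolp classical_sets functions reals.
From mathcomp Require Export complex.

Set Implicit Arguments.
Unset Strict Implicit.
Unset Printing Implicit Defensive.

Import Order.TTheory GRing.Theory Num.Theory.
Local Open Scope ring_scope.
Local Open Scope classical_set_scope.
Local Open Scope sesquilinear_scope.

Section StarAlgebra.
Variable C : numClosedFieldType.

(* M ^t* is the conjugate transpose; A need not contain 1%:M. *)
Definition matrix_star_algebra (n : nat) (A : set 'M[C]_n) : Prop :=
  [/\ submod_closed [in A],
      {in A &, forall X Y, X *m Y \in A} &
      {in A, forall X, X ^t* \in A}].

(* A map between sets of matrices is given by a function on the ambient
   matrix spaces, whose values outside of A are irrelevant. *)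
Definition star_homomorphism (n p : nat) (A : set 'M[C]_n) (B : set 'M[C]_p)
    (f : 'M[C]_n -> 'M[C]_p) : Prop :=
  [/\ set_fun A B f,
      forall a : C, {in A &, forall X Y, f (a *: X + Y) = a *: f X + f Y},
      {in A &, forall X Y, f (X *m Y) = f X *m f Y} &
      {in A, forall X, f (X ^t* ) = (f X) ^t*}].

Definition star_isomorphism (n p : nat) (A : set 'M[C]_n) (B : set 'M[C]_p)
    (f : 'M[C]_n -> 'M[C]_p) : Prop :=
  star_homomorphism A B f /\ set_bij A B f.

Definition direct_sum_mx (d : nat) (m : 'I_d -> nat) :
    set 'M[C]_(\sum_(k < d) m k) :=
  range (fun B : forall k, 'M[C]_(m k) => \mxdiag_(k < d) B k).

Lemma direct_sum_mx_star_algebra (d : nat) (m : 'I_d -> nat) :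
  matrix_star_algebra (@direct_sum_mx d m).
Proof.
split.
- split=> [|a _ _ /set_mem[B _ <-] /set_mem[D _ <-]]; apply/mem_set.
    by exists (fun k => 0) => //; exact: mxdiag0.
  exists (fun k => a *: B k + D k) => //; rewrite mxdiagD; congr (_ + _).
  apply/matrixP => i j; rewrite !mxE; move: (tagnat.sig2 i) (tagnat.sig2 j).
  case: eqVneq => [<-|_] k l; first by rewrite !conform_mx_id !mxE.
  by rewrite !mxE mulr0.
- move=> _ _ /set_mem[B _ <-] /set_mem[D _ <-]; apply/mem_set.
  exists (fun k => B k *m D k) => //.
  rewrite [X in _ *m X]/mxdiag mul_mxdiag_mxblock; apply: eq_mxblock => i j.
  by case: eqVneq => [->|_]; rewrite ?conform_mx_id ?mulmx0.
- move=> _ /set_mem[B _ <-]; apply/mem_set.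
  exists (fun k => (B k) ^t* ) => //; rewrite tr_mxdiag.
  apply/matrixP => i j; rewrite !mxE; move: (tagnat.sig2 i) (tagnat.sig2 j).
  case: eqVneq => [<-|_] k l; first by rewrite !conform_mx_id !mxE.
  by rewrite !mxE rmorph0.
Qed.

End StarAlgebra.

Arguments direct_sum_mx C {d} m.

(* Main.v *)
(* Take a nonzero hermitian H in A of minimal rank. For every matrix X some
   H X H - c H has smaller rank than H, hence vanishes when it lies in A; so a
   multiple p of H is a projection with p A p = C p. On the left ideal A p the
   Hilbert-Schmidt inner product then satisfies X^* Y = (\tr (X^* Y) / t) p,
   t = \tr p, so that an orthonormal basis (e_i) of A p yields matrix units
   t e_i e_j^* of A. Their diagonal sum u is a central projection of A: the
   coefficients X e_i = \sum_j c_ji e_j give the block M_m, and the complement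
   {X in A | X u = 0} is a *-algebra of smaller dimension. *)
Require Import Defs.
From mathcomp Require Import all_boot all_order all_algebra.
From mathcomp Require Import sesquilinear spectral.
From mathcomp Require Import boolp classical_sets functions reals complex.

Set Implicit Arguments.
Unset Strict Implicit.
Unset Printing Implicit Defensive.

Local Open Scope ring_scope.

Import Order.TTheory GRing.Theory Num.Theory.
Local Open Scope sesquilinear_scope.

Section Wedderburn.
Variable C : numClosedFieldType.
Implicit Types n m : nat.

(** * Conjugate transpose and the Hilbert-Schmidt inner product *)

Lemma trmxCM m n p (X : 'M[C]_(m, n)) (Y : 'M[C]_(n, p)) :
  (X *m Y) ^t* = Y ^t* *m X ^t*.
Proof. by rewrite trmx_mul map_mxM. Qed.

Lemma trmxCB m n (X Y : 'M[C]_(m, n)) : (X - Y) ^t* = X ^t* - Y ^t*.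
Proof. by apply/matrixP => i j; rewrite !mxE rmorphB. Qed.

Lemma trmxC_scale m n a (X : 'M[C]_(m, n)) : (a *: X) ^t* = a^* *: X ^t*.
Proof. by apply/matrixP => i j; rewrite !mxE rmorphM. Qed.

Lemma trmxC_sum m n (I : finType) (F : I -> 'M[C]_(m, n)) :
  (\sum_i F i) ^t* = \sum_i (F i) ^t*.
Proof. by rewrite linear_sum /= map_mx_sum. Qed.

Lemma mxtrace_trmxC n (X : 'M[C]_n) : \tr (X ^t*) = (\tr X)^*.
Proof. by rewrite /mxtrace rmorph_sum; apply: eq_bigr => i _; rewrite !mxE. Qed.

Lemma mxtrace_trmxC_mul_eq0 m n (X : 'M[C]_(m, n)) :
  \tr (X ^t* *m X) = 0 -> X = 0.
Proof.
move=> trX0; apply/matrixP => i j; rewrite mxE; apply/eqP.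
have ge0 k : 0 <= (X ^t* *m X) k k.
  by rewrite mxE sumr_ge0 // => l _; rewrite !mxE mulrC mul_conjC_ge0.
have /eqP : (X ^t* *m X) j j = 0.
  apply/eqP; move/eqP: trX0; rewrite /mxtrace psumr_eq0 //.
  by move=> /allP/(_ j); rewrite mem_index_enum => /(_ isT).
rewrite mxE psumr_eq0 => [|k _]; last by rewrite !mxE mulrC mul_conjC_ge0.
move=> /allP/(_ i); rewrite mem_index_enum => /(_ isT).
by rewrite !mxE mulrC mul_conjC_eq0.
Qed.

Lemma trmxC_mul_eq0 m n (X : 'M[C]_(m, n)) : X ^t* *m X = 0 -> X = 0.
Proof. by move=> X0; apply: mxtrace_trmxC_mul_eq0; rewrite X0 mxtrace0. Qed.

(** Transports the Hilbert-Schmidt inner product to the standard one on row vectors, where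
    Gram-Schmidt applies. *)
Lemma mxtrace_trmxC_mul m n (X Y : 'M[C]_(m, n)) :
  \tr (X ^t* *m Y) = (mxvec Y *m (mxvec X) ^t*) 0 0.
Proof.
have -> : \tr (X ^t* *m Y) = \sum_j \sum_i (X i j)^* * Y i j.
  by apply: eq_bigr => j _; rewrite mxE; apply: eq_bigr => i _; rewrite !mxE.
rewrite mxE (reindex _ (curry_mxvec_bij _ _)) /= exchange_big pair_bigA.
by apply: eq_bigr => -[i j] _ /=; rewrite !mxE !mxvecE mulrC.
Qed.

(** * Linear subspaces of matrices: dimension and orthonormal bases *)

Section Closed.
Variables (n : nat) (S : set 'M[C]_n).
Hypothesis S_closed : submod_closed [in S].

Lemma submod_closed_lin a X Y : X \in S -> Y \in S -> a *: X + Y \in S.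
Proof. by case: S_closed => _; apply. Qed.

Lemma submod_closed_scale a X : X \in S -> a *: X \in S.
Proof.
by move=> SX; rewrite -[_ *: _]addr0 submod_closed_lin //; case: S_closed.
Qed.

Lemma submod_closed_sum (I : finType) (F : I -> 'M[C]_n) :
  (forall i, F i \in S) -> \sum_i F i \in S.
Proof.
move=> SF; apply: (big_ind (fun X => X \in S)) => // [|X Y SX SY].
  by case: S_closed.
by rewrite -[X]scale1r submod_closed_lin.
Qed.

Lemma submod_closed_sub X Y : X \in S -> Y \in S -> X - Y \in S.
Proof. by move=> SX SY; rewrite addrC -scaleN1r submod_closed_lin. Qed.

(** A row space of maximal rank inside [S] is all of [S], since a missed vector could be adjoined.
    The rank of [B] then serves as the dimension of [S]. *)
Lemma submod_closed_mxvec :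
  exists B : 'M[C]_(n * n), forall X, (X \in S) = (mxvec X <= B)%MS.
Proof.
pose P r := `[< exists B : 'M[C]_(n * n),
  \rank B = r /\ forall X, (mxvec X <= B)%MS -> X \in S >].
have P0 : exists r, P r.
  exists 0; apply/asboolP; exists 0; split=> [|X]; first exact: mxrank0.
  by rewrite submx0 mxvec_eq0 => /eqP->; case: S_closed.
have Pmax r : P r -> (r <= n * n)%N.
  by move=> /asboolP[B [<- _]]; exact: rank_leq_row.
case: (ex_maxnP P0 Pmax) => r /asboolP[B [rB BS]] rmax.
exists B => X; apply/idP/idP => [SX|]; last exact: BS.
apply: contraT => nXB.
have /rmax : P (\rank (B + mxvec X)%MS).
  apply/asboolP; exists (B + mxvec X)%MS; split=> // Y /sub_addsmxP[[u v]] /=.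
  rewrite [v]mx11_scalar mul_scalar_mx => /(canRL mxvecK) ->.
  rewrite linearD linearZ /= mxvecK addrC submod_closed_lin // BS //.
  by rewrite vec_mxK submxMl.
rewrite -rB leqNgt => /negP[]; apply: rank_ltmx.
by rewrite ltmxE addsmxSl addsmx_sub submx_refl.
Qed.

Lemma orthonormal_basis : exists m (e : 'I_m -> 'M[C]_n),
  [/\ forall i, e i \in S,
      forall i j, \tr ((e i) ^t* *m e j) = (i == j)%:R &
      forall X, X \in S -> X = \sum_i \tr ((e i) ^t* *m X) *: e i].
Proof.
have [B SB] := submod_closed_mxvec.
pose E := schmidt (row_base B).
have EB : (E :=: B)%MS.
  exact: eqmx_trans (eqmx_schmidt_free (row_base_free B)) (eq_row_base B).
have /unitarymxP EE : E \is unitarymx.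
  by rewrite schmidt_unitarymx ?rank_leq_row.
exists (\rank B), (fun i => vec_mx (row i E)); split=> [i|i j|X].
- by rewrite SB vec_mxK -EB row_sub.
- rewrite mxtrace_trmxC_mul !vec_mxK.
  have /matrixP/(_ j i) := EE.
  by rewrite !mxE eq_sym => <-; apply: eq_bigr => k _; rewrite !mxE.
rewrite SB -EB => /submxP[D XE]; apply: (can_inj mxvecK).
rewrite linear_sum /= {1}XE mulmx_sum_row; apply: eq_bigr => i _.
rewrite linearZ /= vec_mxK; congr (_ *: _).
(* The rows of [E] are orthonormal, so [D = D *m E *m E ^t*], which is [mxvec X *m E ^t*]: its
   entries are the inner products. *)
rewrite mxtrace_trmxC_mul vec_mxK -[D in LHS]mulmx1 -EE mulmxA -XE !mxE.
by apply: eq_bigr => k _; rewrite !mxE.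
Qed.

End Closed.

(** * Minimal projections and minimal left ideals *)

(** Factor [H = Z *m Y] through its rank and let [c] be an eigenvalue of the square matrix
    [M = Y *m X *m Z]: the difference is [Z *m ((M - c%:M) *m Y)], with a singular factor in the
    middle. *)
Lemma exists_mxrank_sub_scale_lt n (H X : 'M[C]_n) :
  H != 0 -> exists c, (\rank (H *m X *m H - c *: H)%R < \rank H)%N.
Proof.
move=> H0; set Y := row_base H; set Z := col_base H.
have HE : H = Z *m Y by rewrite mulmx_base.
have r_gt0 : (0 < \rank H)%N by rewrite lt0n mxrank_eq0.
have [c /eigenvalueP[v vc v0]] := eigenvalue_closed (Y *m X *m Z) r_gt0.
exists c; set M := Y *m X *m Z in vc.
have -> : H *m X *m H - c *: H = Z *m ((M - c%:M) *m Y).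
  rewrite mulmxBl mulmxBr mul_scalar_mx -scalemxAr -HE {1 2}HE /M.
  by rewrite !mulmxA.
apply: leq_ltn_trans (mxrankM_maxr _ _) _.
apply: leq_ltn_trans (mxrankM_maxl _ _) _.
rewrite ltn_neqAle rank_leq_row andbT; apply: contraNneq v0 => Mfull.
have Mfree : row_free (M - c%:M) by apply/eqP.
apply/eqP/(row_free_inj Mfree).
by rewrite mul0mx mulmxBr mul_mx_scalar vc subrr.
Qed.

Lemma minimal_projection n (A : set 'M[C]_n) :
  matrix_star_algebra A -> (exists2 X, X \in A & X != 0) ->
  exists p, [/\ p \in A, p != 0, p ^t* = p, p *m p = p &
    {in A, forall X, exists c, p *m X *m p = c *: p}].
Proof.
move=> [Acl Amul Astar] [X0 AX0 X0n0].
pose P r := `[< exists X, [/\ X \in A, X != 0 & \rank X = r] >].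
have exP : exists r, P r by exists (\rank X0); apply/asboolP; exists X0.
case: (ex_minnP exP) => r /asboolP[X [AX Xn0 rX]] rmin.
have rank0 Y : Y \in A -> (\rank Y < r)%N -> Y = 0.
  move=> AY; apply: contraTeq => Yn0; rewrite -leqNgt; apply: rmin.
  by apply/asboolP; exists Y.
(* Replaces [X] by a hermitian element without raising the rank. *)
pose H := X ^t* *m X.
have AH : H \in A by rewrite Amul ?Astar.
have Hn0 : H != 0 by apply: contraNneq Xn0 => /trmxC_mul_eq0->.
have Hherm : H ^t* = H by rewrite trmxCM trmxCK.
have rH : (\rank H <= r)%N by rewrite -rX mxrankM_maxr.
clearbody H.
(* The identity may lie outside [A], but [H *m H - c *: H] is in [A], so its small rank makes it
   zero. *)
have [c] := exists_mxrank_sub_scale_lt 1%:M Hn0; rewrite mulmx1 => /leq_trans/(_ rH).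
move=> /rank0; rewrite submod_closed_sub ?submod_closed_scale ?Amul //.
move=> /(_ isT)/eqP; rewrite subr_eq0 => /eqP HH.
have cn0 : c != 0.
  apply: contraNneq Hn0 => c0; apply/eqP/trmxC_mul_eq0.
  by rewrite Hherm HH c0 scale0r.
have cconj : c^* = c.
  have : (H *m H) ^t* = c^* *: H by rewrite HH trmxC_scale Hherm.
  rewrite trmxCM Hherm HH => /eqP.
  by rewrite -subr_eq0 -scalerBl scaler_eq0 (negPf Hn0) orbF subr_eq0 => /eqP.
exists (c^-1 *: H); split.
- exact: submod_closed_scale.
- by rewrite scaler_eq0 invr_eq0 negb_or cn0.
- by rewrite trmxC_scale Hherm fmorphV /= cconj.
- rewrite -scalemxAl -scalemxAr HH [c^-1 *: (c *: H)]scalerA.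
  by rewrite mulVf // scale1r.
move=> Y AY; have [d] := exists_mxrank_sub_scale_lt Y Hn0 => /leq_trans/(_ rH).
move=> /rank0; rewrite submod_closed_sub ?submod_closed_scale ?Amul //.
move=> /(_ isT)/eqP; rewrite subr_eq0 => /eqP HYH.
by exists (c^-1 * d); rewrite -!scalemxAl -scalemxAr HYH !scalerA mulrAC.
Qed.

(** With [p] the minimal projection, [e j] and [e k] absorb [p] on the right, so [(e j) ^t* *m e k]
    is a multiple of [p], and its trace fixes the scalar. A factor [e i] on the left absorbs this
    [p], which keeps [p] out of the statement. *)
Lemma minimal_left_ideal n (A : set 'M[C]_n) :
  matrix_star_algebra A -> (exists2 X, X \in A & X != 0) ->
  exists m (e : 'I_m -> 'M[C]_n) t, [/\ (0 < m)%N, t != 0 /\ t^* = t,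
    forall i, e i \in A,
    forall i j, \tr ((e i) ^t* *m e j) = (i == j)%:R &
    (forall i j k, e i *m ((e j) ^t* *m e k) = ((j == k)%:R / t) *: e i) /\
    {in A, forall X i, X *m e i = \sum_j \tr ((e j) ^t* *m (X *m e i)) *: e j}].
Proof.
move=> Aalg /(minimal_projection Aalg)[p [Ap pn0 pherm pp pAp]].
have [Acl Amul Astar] := Aalg.
pose S : set 'M[C]_n := fun X => X \in A /\ X *m p = X.
have SP X : X \in S <-> X \in A /\ X *m p = X by split=> [/set_mem|/mem_set].
have Scl : submod_closed [in S].
  split=> [|a X Y /SP[AX Xp] /SP[AY Yp]]; apply/SP; rewrite ?mul0mx.
    by case: Acl.
  by rewrite submod_closed_lin // mulmxDl -scalemxAl Xp Yp.
have [m [e [Se ee eS]]] := orthonormal_basis Scl.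
pose t := \tr p.
have tn0 : t != 0.
  apply: contraNneq pn0 => t0; apply/eqP/mxtrace_trmxC_mul_eq0.
  by rewrite pherm pp.
have Sp : p \in S by apply/SP.
exists m, e, t; split=> //.
(* If [m] were 0, [p] would be an empty sum. *)
- case: m e Se ee eS => // e _ _ /(_ p Sp) p0.
  by move: pn0; rewrite p0 big_ord0 eqxx.
- by rewrite -mxtrace_trmxC pherm.
- by move=> i; have /SP[] := Se i.
split=> [i j k|X AX i]; last first.
  by apply: eS; have /SP[? ep] := Se i; apply/SP; rewrite Amul // -mulmxA ep.
have [/SP[_ eip] /SP[Aj ejp] /SP[Ak ekp]] := And3 (Se i) (Se j) (Se k).
have [d ejk] : exists d, (e j) ^t* *m e k = d *: p.
  have [d pd] := pAp ((e j) ^t* *m e k) (Amul _ _ (Astar _ Aj) Ak).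
  by exists d; rewrite -pd -{1}ejp -{1}ekp trmxCM pherm !mulmxA.
have := ee j k; rewrite ejk mxtraceZ => <-.
by rewrite mulfK // -scalemxAr eip.
Qed.

(** * Splitting off one block at a time *)

(* Surjectivity is stated one block at a time, so that reindexing [I] needs no
   cast between the types ['M_(m i)]. *)
Definition block_decomposition n (A : set 'M[C]_n) (I : finType) (m : I -> nat)
    (f : forall i, 'M[C]_n -> 'M[C]_(m i)) : Prop :=
  [/\ forall i, (0 < m i)%N,
      forall i, linear (f i),
      forall i, {in A &, forall X Y, f i (X *m Y) = f i X *m f i Y} /\
        {in A, forall X, f i (X ^t*) = (f i X) ^t*},
      {in A, forall X, (forall i, f i X = 0) -> X = 0} &
      forall i M, exists X, [/\ X \in A, f i X = M &
        forall j, j != i -> f j X = 0]].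

(** Induction on the dimension of [A], measured by the rank of [B]; the zero algebra has no
    blocks. *)
Lemma exists_block_decomposition n (A : set 'M[C]_n) :
  matrix_star_algebra A ->
  exists (I : finType) (m : I -> nat) (f : forall i, 'M[C]_n -> 'M[C]_(m i)),
    block_decomposition A f.
Proof.
move=> Aalg; have [B AB] : exists B : 'M[C]_(n * n),
    forall X, (X \in A) = (mxvec X <= B)%MS.
  by case: Aalg => Acl _ _; exact: submod_closed_mxvec.
have [r] := ubnP (\rank B); elim: r => // r IHr in A B Aalg AB * => rB.
have [/(minimal_left_ideal Aalg)|A0] := pselect (exists2 X, X \in A & X != 0);
  last first.
  have {}A0 X : X \in A -> X = 0.
    by move=> AX; apply/eqP; apply: contraPT A0 => ? []; exists X.
  exists void, (fun=> 0), (fun i : void => match i with end).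
  by split=> [[]|[]|[]|X /A0->|[]].
move=> [m [e [t [m_gt0 [tn0 tconj] Ae ee [eee eX]]]]].
have [Acl Amul Astar] := Aalg.
pose c X := \matrix_(j, i) \tr ((e j) ^t* *m (X *m e i)) : 'M[C]_m.
have {}eX X i : X \in A -> X *m e i = \sum_j c X j i *: e j.
  by move=> AX; rewrite eX //; apply: eq_bigr => j _; rewrite mxE.
have c_lin : linear c.
  move=> a X Y; apply/matrixP => j i; rewrite !mxE.
  by rewrite mulmxDl mulmxDr -scalemxAl -scalemxAr linearP.
have c_mul X Y : X \in A -> Y \in A -> c (X *m Y) = c X *m c Y.
  move=> AX AY; apply/matrixP => j i; rewrite [LHS]mxE -mulmxA eX //.
  rewrite mulmx_sumr mulmx_sumr linear_sum mxE /=; apply: eq_bigr => k _.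
  by rewrite -!scalemxAr mxtraceZ mulrC [c X j k]mxE.
(* By orthonormality [c X] is the compression of left multiplication by [X] to the span of the
   [e i], and compression commutes with adjoints. *)
have c_star X : c (X ^t*) = (c X) ^t*.
  apply/matrixP => j i; rewrite !mxE -mxtrace_trmxC !trmxCM trmxCK.
  by rewrite mulmxA.
pose u := t *: \sum_i e i *m (e i) ^t*.
have Au : u \in A.
  apply: submod_closed_scale => //; apply: submod_closed_sum => // i.
  by rewrite Amul ?Astar.
have u_herm : u ^t* = u.
  rewrite trmxC_scale tconj; congr (_ *: _); rewrite trmxC_sum.
  by apply: eq_bigr => i _; rewrite trmxCM trmxCK.
have XuE X : X \in A ->
    X *m u = t *: \sum_i \sum_j c X j i *: (e j *m (e i) ^t*).
  move=> AX; rewrite -scalemxAr mulmx_sumr; congr (_ *: _).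
  apply: eq_bigr => i _; rewrite mulmxA eX // mulmx_suml.
  by apply: eq_bigr => j _; rewrite -scalemxAl.
(* [u *m X] is the adjoint of [X ^t* *m u]; expanding the latter by [XuE] and applying [c_star]
   gives the double sum for [X *m u] with the indices exchanged. *)
have uC X : X \in A -> u *m X = X *m u.
  move=> AX; rewrite -[X in LHS]trmxCK -{1}u_herm -trmxCM XuE ?Astar //.
  rewrite XuE // trmxC_scale tconj; congr (_ *: _).
  rewrite trmxC_sum [RHS]exchange_big; apply: eq_bigr => i _.
  rewrite trmxC_sum; apply: eq_bigr => j _.
  by rewrite trmxC_scale trmxCM trmxCK c_star !mxE conjCK.
have ue j : u *m e j = e j.
  rewrite -scalemxAl mulmx_suml scaler_sumr (bigD1 j) //= big1 => [|i ij].
    by rewrite -mulmxA eee eqxx scalerA mulrA mulr1 mulfV // scale1r addr0.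
  by rewrite -mulmxA eee (negPf ij) mul0r scale0r scaler0.
have uu : u *m u = u.
  rewrite {2}/u -scalemxAr mulmx_sumr; congr (_ *: _).
  by apply: eq_bigr => i _; rewrite mulmxA ue.
pose J : set 'M[C]_n := fun X => X \in A /\ X *m u = 0.
have JP X : X \in J <-> X \in A /\ X *m u = 0 by split=> [/set_mem|/mem_set].
have Jalg : matrix_star_algebra J.
  split.
  - split=> [|a X Y /JP[AX Xu] /JP[AY Yu]]; apply/JP; rewrite ?mul0mx.
      by case: Acl.
    by rewrite submod_closed_lin // mulmxDl -scalemxAl Xu Yu scaler0 addr0.
  - move=> X Y /JP[AX Xu] /JP[AY Yu]; apply/JP.
    by rewrite Amul // -mulmxA Yu mulmx0.
  - move=> X /JP[AX Xu]; apply/JP; rewrite Astar //.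
    by rewrite -{1}u_herm -trmxCM uC // Xu trmx0 map_mx0.
have [BJ JB] : exists B : 'M[C]_(n * n),
    forall X, (X \in J) = (mxvec X <= B)%MS.
  by case: Jalg => Jcl _ _; exact: submod_closed_mxvec.
have ltBJ : (\rank BJ < r)%N.
  rewrite ltnS in rB; apply: leq_trans rB; apply: rank_ltmx.
  rewrite ltmxE; apply/andP; split.
    apply/row_subP => i; rewrite -[row i BJ]vec_mxK -AB.
    by have /JP[] : vec_mx (row i BJ) \in J by rewrite JB vec_mxK row_sub.
  (* The dimension drops strictly: [u] fixes the nonzero element [e i0] of [A], which is therefore
     not in [J]. *)
  pose i0 := Ordinal m_gt0; apply/negP => leB.
  have /JP[_] : e i0 \in J by rewrite JB (submx_trans _ leB) // -AB.
  rewrite -uC // ue => e0; have := ee i0 i0.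
  by rewrite e0 mulmx0 mxtrace0 eqxx => /esym/eqP; rewrite oner_eq0.
have [I [mI [g [mI_gt0 g_lin g_hom g_inj g_surj]]]] := IHr J BJ Jalg JB ltBJ.
have JX X : X \in A -> X - X *m u \in J.
  move=> AX; apply/JP; rewrite submod_closed_sub ?Amul //.
  by rewrite mulmxBl -mulmxA uu subrr.
exists (option I), (fun o => if o is Some i then mI i else m).
(* [X] splits as [(X - X *m u) + X *m u]. The old blocks read the first part; the new block [None]
   sees only the second, because [u] fixes every [e i]. *)
exists (fun o => match o return
    'M[C]_n -> 'M[C]_(if o is Some i then mI i else m) with
  | Some i => fun X => g i (X - X *m u) | None => c end).
split=> [[i|] //|[i|] //|[i|]|X AX fX|[i|] M].
- move=> a X Y; rewrite -g_lin; congr (g i _).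
  by rewrite mulmxDl -scalemxAl scalerBr opprD addrACA.
- have [gM gS] := g_hom i; split=> [X Y AX AY|X AX].
    rewrite -gM ?JX //; congr (g i _).
    (* For the central idempotent [u], the product of [X - X *m u] and [Y - Y *m u] is
       [X *m Y - X *m Y *m u]. *)
    rewrite mulmxBr !mulmxBl -!mulmxA (uC (Y *m u)) ?Amul // -!mulmxA uu.
    by rewrite (uC Y) // subrr subr0.
  rewrite -gS ?JX //; congr (g i _).
  by rewrite trmxCB trmxCM u_herm uC ?Astar.
- by split=> [X Y AX AY|X AX]; [exact: c_mul | exact: c_star].
(* The [None] component determines [X *m u]; when it vanishes, [X] lies in [J], where the [g i] are
   jointly injective. *)
- have Xu : X *m u = 0.
    rewrite XuE //; apply/eqP; rewrite scaler_eq0 (negPf tn0) /=; apply/eqP.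
    rewrite big1 // => i _; rewrite big1 // => j _.
    by have := fX None => /= ->; rewrite mxE scale0r.
  apply: g_inj; first by apply/JP.
  by move=> i; have /= := fX (Some i); rewrite Xu subr0.
- have [X [/JP[AX Xu] giX gX]] := g_surj i M.
  exists X; split=> //; first by rewrite Xu subr0.
  move=> [j ji|_]; first by rewrite Xu subr0 gX.
  (* Elements of [J] annihilate [e k], since [e k = u *m e k]. *)
  apply/matrixP => j k; rewrite !mxE.
  by rewrite -(ue k) [X *m _]mulmxA Xu mul0mx mulmx0 mxtrace0.
pose X := t *: \sum_l \sum_k M k l *: (e k *m (e l) ^t*).
have AX : X \in A.
  apply: submod_closed_scale => //; apply: submod_closed_sum => // l.
  apply: submod_closed_sum => // k; apply: submod_closed_scale => //.
  by rewrite Amul ?Astar.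
exists X; split=> //.
  apply/matrixP => j i; rewrite mxE.
  have -> : X *m e i = \sum_k M k i *: e k.
    rewrite -scalemxAl mulmx_suml (bigD1 i) //= [X in _ + X]big1 => [|l li].
      rewrite addr0 mulmx_suml scaler_sumr; apply: eq_bigr => k _.
      rewrite -scalemxAl -mulmxA eee eqxx !scalerA -mulrA mul1r.
      by rewrite mulrCA mulfV // mulr1.
    rewrite mulmx_suml big1 // => k _.
    by rewrite -scalemxAl -mulmxA eee (negPf li) mul0r scale0r scaler0.
  rewrite mulmx_sumr linear_sum /= (bigD1 j) //= big1 => [|k kj].
    by rewrite -scalemxAr mxtraceZ ee eqxx mulr1 addr0.
  by rewrite -scalemxAr mxtraceZ ee eq_sym (negPf kj) mulr0.
move=> [j _|//].
have Xu : X *m u = X.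
  rewrite -uC // -scalemxAr mulmx_sumr; congr (_ *: _); apply: eq_bigr => l _.
  rewrite mulmx_sumr; apply: eq_bigr => k _.
  by rewrite -scalemxAr mulmxA ue.
(* Linearity at [-1], 0, 0 yields [g j 0 = 0]. *)
by have := g_lin j (-1) 0 0; rewrite Xu subrr scaler0 addr0 scaleN1r addNr.
Qed.

(** * Assembling the blocks into a direct sum *)

Lemma block_decomposition_ord n (A : set 'M[C]_n) (I : finType) (m : I -> nat)
    (f : forall i, 'M[C]_n -> 'M[C]_(m i)) : matrix_star_algebra A ->
  block_decomposition A f ->
  star_isomorphism A (direct_sum_mx C (fun k : 'I_#|I| => m (enum_val k)))
    (fun X => \mxdiag_k f (enum_val k) X).
Proof.
move=> [Acl Amul Astar] [_ f_lin f_hom f_inj f_surj].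
have f_zero i : f i 0 = 0.
  by have := f_lin i (-1) 0 0; rewrite scaler0 addr0 scaleN1r addNr.
have f_add i : {morph f i : X Y / X + Y}.
  by move=> X Y; have := f_lin i 1 X Y; rewrite !scale1r.
have fun_f : set_fun A (direct_sum_mx C (fun k : 'I_#|I| => m (enum_val k)))
    (fun X => \mxdiag_k f (enum_val k) X).
  by move=> X _; exists (fun k => f (enum_val k) X).
split; split=> //.
- move=> a X Y _ _.
  transitivity (\mxdiag_(k < #|I|) (a *: f (enum_val k) X + f (enum_val k) Y)).
    by apply: eq_mxdiag => k; rewrite f_lin.
  (* [mxdiag] commutes with scaling: the entries agree inside a diagonal block, and elsewhere both
     sides are 0. *)
  rewrite mxdiagD; congr (_ + _); apply/matrixP => i j; rewrite !mxE.
  move: (tagnat.sig2 i) (tagnat.sig2 j).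
  case: eqVneq => [<-|_] k l; first by rewrite !conform_mx_id !mxE.
  by rewrite !mxE mulr0.
- move=> X Y AX AY; rewrite [X in _ = _ *m X]/mxdiag mul_mxdiag_mxblock.
  apply: eq_mxblock => i j; have [fM _] := f_hom (enum_val i).
  by case: eqVneq => [<-|_]; rewrite ?conform_mx_id ?mulmx0 ?fM.
- move=> X AX; rewrite tr_mxdiag; apply/matrixP => i j; rewrite !mxE.
  move: (tagnat.sig2 i) (tagnat.sig2 j).
  have [_ fS] := f_hom (enum_val (tagnat.sig1 i)).
  case: eqVneq => [<-|_] k l; first by rewrite !conform_mx_id fS // !mxE.
  by rewrite !mxE rmorph0.
- move=> X Y AX AY /eq_mxdiagP fXY; apply/eqP; rewrite -subr_eq0; apply/eqP.
  apply: f_inj => [|i]; first by rewrite submod_closed_sub.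
  by rewrite addrC -scaleN1r f_lin scaleN1r -(enum_rankK i) fXY addNr.
move=> _ [D _ <-].
(* Each [x k] maps to [D k] in block [k] and to 0 in the others, so the sum of the [x k] realizes
   all blocks at once. *)
have [x xP] := choice (fun k : 'I_#|I| => f_surj (enum_val k) (D k)).
exists (\sum_k x k).
  by apply/set_mem; apply: submod_closed_sum => // k; have [] := xP k.
apply: eq_mxdiag => k.
rewrite (big_morph (f (enum_val k)) (f_add _) (f_zero _)).
rewrite (bigD1 k) //= big1.
  by rewrite addr0; have [] := xP k.
move=> j jk; have [_ _] := xP j; apply.
by rewrite (can_eq enum_valK) eq_sym.
Qed.
End Wedderburn.

Theorem theorem1p2 (R : realType) (n : nat) (A : set 'M[R[i]]_n) :
  matrix_star_algebra A ->
  exists (d : nat) (m : 'I_d -> nat),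
    (forall k : 'I_d, (0 < m k)%N) /\
    exists phi : 'M[R[i]]_n -> 'M[R[i]]_(\sum_(k < d) m k),
      star_isomorphism A (direct_sum_mx R[i] m) phi.
Proof.
move=> Aalg; have [I [m [f fA]]] := exists_block_decomposition Aalg.
exists #|I|, (fun k => m (enum_val k)); split; first by case: fA.
by eexists; exact: block_decomposition_ord fA.
Qed.
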